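(* For $B\ge 2$ one has $$ N(B)-N_0(B)=\Big(\frac{48}{\zeta(3)}-\frac{12}{\zeta(2)}\Big)B+O\big(B^{3/4}(\log B)^2\big), $$ with an absolute implied constant.
   Context: Let $\mathscr V\subset\mathbb{P}^2\times\mathbb{P}^2$ be the biprojective variety defined by $x_0y_0+x_1y_1+x_2y_2=0$, where $x=(x_0:x_1:x_2)$ and $y=(y_0:y_1:y_2)$, and let $\mathscr U\subset\mathscr V$ be the Zariski open subset where none of the six coordinates $x_0,x_1,x_2,y_0,y_1,y_2$ vanishes. For $\mathbf{x}\in\mathbb{Z}^3$ write $|\mathbf{x}|=\max(|x_0|,|x_1|,|x_2|)$; a vector in $\mathbb{Z}^3$ is primitive if the greatest common divisor of its coordinates is $1$. The height of a rational point $(x,y)$ of $\mathscr V$ represented by primitive $\mathbf{x},\mathbf{y}\in\mathbb{Z}^3$ (each unique up to sign) is $|\mathbf{x}|^2|\mathbf{y}|^2$. $N(B)$ is the number of rational points on $\mathscr V$ of height not exceeding $B$, and $N_0(B)$ is the number of those points that lie in $\mathscr U$. $\zeta$ is the Riemann zeta function. *)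

(* Defs.v *)
From mathcomp Require Import all_boot all_order all_algebra.
From mathcomp Require Import finmap zify.
From mathcomp Require Import all_classical all_reals all_analysis.

Set Implicit Arguments.
Unset Strict Implicit.
Unset Printing Implicit Defensive.

Import Order.TTheory GRing.Theory Num.Theory.
Import numFieldNormedType.Exports.

Local Open Scope classical_set_scope.
Local Open Scope ring_scope.

(* A rational point of the projective plane is a line through the origin
   in Q^3. *)
Notation P2Q := {L : {vspace 'rV[rat]_3} | \dim L == 1%N}.

(* P = (u_0 : u_1 : u_2) *)
Definition hom_coords (u : 'rV[rat]_3) (P : P2Q) : Prop :=
  u != 0 /\ <[u]>%VS = val P.

Definition primitive (x : 'rV[int]_3) : Prop :=
  \big[gcdz/0]_(i < 3) x ord0 i = 1.

Definition represents (x : 'rV[int]_3) (P : P2Q) : Prop :=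
  primitive x /\ hom_coords (map_mx intr x) P.

Definition maxnorm (x : 'rV[int]_3) : nat := \max_(i < 3) `|x ord0 i|%N.

(* A chosen primitive representative of P: it exists by [represents_ex] and is
   unique up to sign by [represents_uniq], so that [maxnorm (prim_rep P)] does
   not depend on the choice (see [height_represents]). *)
Definition prim_rep (P : P2Q) : 'rV[int]_3 := xget 0 [set x | represents x P].

Definition height (p : P2Q * P2Q) : nat :=
  (maxnorm (prim_rep p.1) ^ 2 * maxnorm (prim_rep p.2) ^ 2)%N.

Definition VQ : set (P2Q * P2Q) :=
  [set p | forall u v : 'rV[rat]_3, hom_coords u p.1 -> hom_coords v p.2 ->
     \sum_(i < 3) u ord0 i * v ord0 i = 0].

Definition UQ : set (P2Q * P2Q) :=
  VQ `&` [set p | forall u v : 'rV[rat]_3, hom_coords u p.1 ->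
     hom_coords v p.2 -> forall i : 'I_3, u ord0 i != 0 /\ v ord0 i != 0].

Definition count_le (R : realType) (A : set (P2Q * P2Q)) (B : R) : nat :=
  #|` fset_set (A `&` [set p | (height p)%:R <= B])|%fset.

Definition Ncount (R : realType) (B : R) : nat := count_le VQ B.
Definition N0count (R : realType) (B : R) : nat := count_le UQ B.

(* The Dirichlet series of the Riemann zeta function; meaningful for s > 1. *)
Definition zeta (R : realType) (s : R) : R :=
  limn (series (fun n : nat => n.+1%:R `^ (- s))).

Lemma hom_coords_ex (P : P2Q) : exists u, hom_coords u P.
Proof.
case: P => L /= dL; exists (vpick L).
have nz : vpick L != 0 by rewrite vpick0 -dimv_eq0 (eqP dL).
split=> //=; apply/eqP; rewrite eqEdim (eqP dL) dim_vline nz andbT.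
by rewrite -memvE memv_pick.
Qed.

Lemma hom_coords_scale (u v : 'rV[rat]_3) (P : P2Q) :
  hom_coords u P -> hom_coords v P -> exists2 c, c != 0 & v = c *: u.
Proof.
move=> [u0 uP] [v0 vP].
have /vlineP[c vE] : v \in <[u]>%VS by rewrite uP -vP memv_line.
exists c => //; apply: contra_neq v0 => c0.
by rewrite vE c0 scale0r.
Qed.

Lemma scale_hom_coords (c : rat) (u : 'rV[rat]_3) (P : P2Q) :
  c != 0 -> hom_coords u P -> hom_coords (c *: u) P.
Proof.
move=> c0 [u0 uP]; have cu0 : c *: u != 0 by rewrite scaler_eq0 negb_or c0.
split=> //; rewrite -uP; apply/eqP.
by rewrite eqEdim !dim_vline u0 cu0 /= andbT -memvE memvZ ?memv_line.
Qed.

Lemma big_gcdzM (x : 'rV[int]_3) (a : int) :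
  \big[gcdz/0]_(i < 3) (a *: x) ord0 i = `|a| * \big[gcdz/0]_(i < 3) x ord0 i.
Proof.
rewrite !big_ord_recl !big_ord0 !mxE !gcdz0.
by rewrite -!abszE /gcdz !abszM -PoszM /= !muln_gcdr.
Qed.

Lemma dvdz_big_gcdz (x : 'rV[int]_3) (d : int) :
  (d %| \big[gcdz/0]_(i < 3) x ord0 i)%Z <-> forall i, (d %| x ord0 i)%Z.
Proof.
split=> [|dx]; last first.
  by apply: (big_ind (fun z => (d %| z)%Z)) => // y z dy dz; rewrite dvdz_gcd dy.
rewrite !big_ord_recl big_ord0 !dvdz_gcd => /and4P[d0 d1 d2 _] i.
by case: (unliftP ord0 i) => [j ->|-> //]; case: (unliftP ord0 j) => [k ->|-> //];
  case: (unliftP ord0 k) => [[]|-> ].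
Qed.

Lemma represents_ex (P : P2Q) : exists x, represents x P.
Proof.
have [u uP] := hom_coords_ex P.
pose d : int := \prod_(i < 3) denq (u ord0 i).
have d0 : d != 0 by apply/prodf_neq0 => i _; rewrite denq_eq0.
pose y : 'rV[int]_3 := \row_i (numq (u ord0 i) *
   \prod_(j < 3 | j != i) denq (u ord0 j)).
have yE : map_mx intr y = d%:~R *: u :> 'rV[rat]_3.
  apply/rowP => i; rewrite !mxE /d [in RHS](bigD1 i) //= !intrM (ord1 0).
  by rewrite numqE mulrC -[RHS]mulrA [RHS]mulrCA (mulrC (u _ _)).
pose g := \big[gcdz/0]_(i < 3) y ord0 i.
have gy i : (g %| y ord0 i)%Z by have /dvdz_big_gcdz := dvdzz g; exact.
pose x : 'rV[int]_3 := \row_i (y ord0 i %/ g)%Z.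
have xE : y = g *: x.
  by apply/rowP => i; rewrite [RHS]mxE [x 0 i]mxE mulrC divzK ?gy.
have yP : hom_coords (map_mx intr y) P.
  by rewrite yE; apply: scale_hom_coords => //; rewrite intr_eq0.
have g0 : g != 0.
  apply: contra_neq yP.1 => g0; rewrite xE g0 scale0r.
  by apply/rowP => i; rewrite !mxE.
have g_ge0 : 0 <= g by rewrite /g big_ord_recl.
exists x; split.
- apply: (mulfI g0); rewrite mulr1 -{1}(ger0_norm g_ge0) -big_gcdzM -xE.
  by [].
- have -> : map_mx intr x = (g%:~R)^-1 *: map_mx intr y :> 'rV[rat]_3.
    rewrite xE; apply/rowP => i; rewrite !mxE intrM mulKf //.
    by rewrite intr_eq0.
  by apply: scale_hom_coords => //; rewrite invr_eq0 intr_eq0.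
Qed.

Lemma represents_uniq (x y : 'rV[int]_3) (P : P2Q) :
  represents x P -> represents y P -> x = y \/ x = - y.
Proof.
move=> [px hx] [py hy]; have [c c0 yE] := hom_coords_scale hx hy.
have E : denq c *: y = numq c *: x.
  apply/rowP => i; apply: (@intr_inj rat).
  have /rowP/(_ i) := yE; rewrite !mxE !intrM => ->.
  by rewrite numqE mulrA (mulrC c).
have : `|denq c| = `|numq c|.
  by rewrite -[LHS]mulr1 -[RHS]mulr1 -{1}py -px -!big_gcdzM E.
move/eqP; rewrite eqr_norm2 => /orP[] /eqP dE; move: E; rewrite dE => E.
- left; apply/rowP => i; have /rowP/(_ i) := E; rewrite !mxE.
  by move/mulfI => -> //; rewrite numq_eq0.
- right; apply/rowP => i; have /rowP/(_ i) := E; rewrite !mxE mulNr -mulrN.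
  by move/mulfI => <- //; rewrite numq_eq0.
Qed.

Lemma maxnormN (x : 'rV[int]_3) : maxnorm (- x) = maxnorm x.
Proof. by apply: eq_bigr => i _; rewrite mxE abszN. Qed.

Lemma prim_repP (P : P2Q) : represents (prim_rep P) P.
Proof. exact: (@xgetPex _ 0 [set x | represents x P] (represents_ex P)). Qed.

Lemma maxnorm_represents (x : 'rV[int]_3) (P : P2Q) :
  represents x P -> maxnorm (prim_rep P) = maxnorm x.
Proof.
by move=> /(represents_uniq (prim_repP P))[->//|->]; rewrite maxnormN.
Qed.

Lemma height_represents (x y : 'rV[int]_3) (p : P2Q * P2Q) :
  represents x p.1 -> represents y p.2 ->
  height p = (maxnorm x ^ 2 * maxnorm y ^ 2)%N.
Proof.
by rewrite /height => /maxnorm_represents -> /maxnorm_represents ->.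
Qed.

Lemma le_maxnorm (x : 'rV[int]_3) (i : 'I_3) : (`|x ord0 i| <= maxnorm x)%N.
Proof. exact: (@leq_bigmax _ (fun i => `|x ord0 i|%N) i). Qed.

Lemma maxnorm_gt0 (P : P2Q) : (0 < maxnorm (prim_rep P))%N.
Proof.
have [_ [x0 _]] := prim_repP P; rewrite lt0n; apply: contra_neq x0 => m0.
apply/rowP => i; rewrite !mxE; apply/eqP; rewrite intr_eq0 -absz_eq0 -leqn0.
by apply: leq_trans (le_maxnorm _ i) _; rewrite m0.
Qed.

(* [fset_set] is the empty set on infinite sets; this shows that [count_le]
   counts a set that is really finite. *)
Lemma finite_height_le (R : realType) (A : set (P2Q * P2Q)) (B : R) :
  finite_set (A `&` [set p | (height p)%:R <= B]).
Proof.
pose n := Num.truncn B.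
pose rep (f : {ffun 'I_3 -> 'I_(n.*2).+1}) : 'rV[int]_3 :=
  \row_i ((f i)%:Z - n%:Z).
pose F (fg : {ffun 'I_3 -> 'I_(n.*2).+1} * {ffun 'I_3 -> 'I_(n.*2).+1}) :
  set (P2Q * P2Q) := [set p | represents (rep fg.1) p.1 /\
                             represents (rep fg.2) p.2].
have repE P : (maxnorm (prim_rep P) <= n)%N -> exists f, rep f = prim_rep P.
  move=> Pn.
  have b i := leq_trans (le_maxnorm (prim_rep P) i) Pn.
  exists [ffun i => inord `|(prim_rep P ord0 i + n%:Z)%R|%N].
  apply/rowP => i; rewrite !mxE ffunE; have := b i; rewrite (ord1 ord0) => bi; rewrite inordK; lia.
apply: (@sub_finite_set _ _ (\bigcup_(fg in [set: _]) F fg)).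
  move=> p [_ /= pB].
  have hn : (height p <= n)%N.
    by rewrite /n truncn_ge_nat // (le_trans _ pB).
  have m1 := maxnorm_gt0 p.1; have m2 := maxnorm_gt0 p.2.
  have [|f fE] := repE p.1; first by move: hn; rewrite /height; nia.
  have [|g gE] := repE p.2; first by move: hn; rewrite /height; nia.
  by exists (f, g) => //=; split; rewrite /= ?fE ?gE; exact: prim_repP.
apply: bigcup_finite => // fg _.
have [->|/set0P[p [p1 p2]]] := eqVneq (F fg) set0; first exact: finite_set0.
apply: (@sub_finite_set _ _ [set p]); last exact: finite_set1.
move=> q [q1 q2] /=.
rewrite [q]surjective_pairing [p]surjective_pairing.
by congr pair; apply: val_inj; [rewrite -q1.2.2 -p1.2.2 | rewrite -q2.2.2 -p2.2.2].
Qed.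

(* Main.v *)
Require Import Defs.
From mathcomp Require Import all_boot all_order all_algebra.
From mathcomp Require Import cyclic.
From mathcomp Require Import finmap zify ring lra.
From mathcomp Require Import all_classical all_reals all_analysis.

(** The difference counts the rational points of the variety with a vanishing
    coordinate. Suppose [x_0 = 0], with [x = (0, a, b)] primitive. The equation
    says that [(y_1, y_2)] is orthogonal to [(a, b)], so that
    [y = (c, t * b, - t * a)] for an integer [t], and [y] is primitive exactly
    when [t] and [c] are coprime. With [m = max(|a|, |b|)], the bound
    [|x|^2 * |y|^2 <= B] becomes [|t| <= T / m^2] and [|c| <= T / m], where [T]
    is the integral part of [sqrt B]. The other five coordinates are similar.

    If [a], [b] and [c] are nonzero (the [generic] case), then [x] has one
    vanishing coordinate and [y] has none or two, so the point determines which
    of the two factors plays the part of [x], and hence all the parameters once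
    signs are normalised ([par_point_inj]); this includes [t = 0], where [y] is
    a unit vector. All remaining points lie in two families with [t + c = 1], the
    [sporadic] ones, which contribute only [O(T)]
    ([boundary_par_point], [size_boundary]). Write [G X Y] for the number of
    coprime pairs in the box [X] by [Y] ([coprime_pairs]) and [G_m] for
    [G (T / m^2) (T / m)]. A sum over coprime pairs [(a, b)] of a function of
    their maximum [m] has weights [2 phi(m)], except that [m = 1] has weight
    [1], and the number of generic points is exactly

      [48 * sum_m phi(m) * G_m - 12 * G T T]

    ([card_generic_param]); here [t <> 0] gives [24 * (2 * sum_m phi(m) * G_m -
    G T T)] and [t = 0] gives [12 * G T T].

    Moebius inversion gives [G_m = T^2 / (m^3 zeta(2)) + O((T / m) log T)]
    ([coprime_pairs_approx]), and [sum_m phi(m) / m^3] equals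
    [zeta(2) / zeta(3)] ([sum_totient_approx]). Since [G_m] vanishes for
    [m > sqrt T], the total error is [O(T^(3/2) log T)], which is
    [O(B^(3/4) log B)]; the constants add up to [48 / zeta(3) - 12 / zeta(2)].

    The values [1 / zeta(2)] and [zeta(2) / zeta(3)] are both obtained with an
    error term from the same truncated Dirichlet product
    ([zeta_mul_sum_approx]), applied to the identities [mu * 1 = delta] and
    [phi * 1 = id]. *)

Set Implicit Arguments.
Unset Strict Implicit.
Unset Printing Implicit Defensive.

Import Order.TTheory GRing.Theory Num.Theory.
Import numFieldNormedType.Exports.

Local Open Scope ring_scope.

(** * Sums over divisors and the Moebius function *)

Lemma sum_multiples (V : nmodType) (k N : nat) (F : nat -> V) :
  (0 < k)%N ->
  \sum_(1 <= n < N.+1 | (k %| n)%N) F n =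
  \sum_(1 <= e < (N %/ k).+1) F (k * e)%N.
Proof.
move=> k0; elim: N => [|N IH]; first by rewrite div0n !big_geq.
rewrite big_mkcond big_nat_recr //= -big_mkcond /= IH divnS //.
case: ifP => kN; last by rewrite addr0.
rewrite add1n [RHS]big_nat_recr //=; congr (_ + F _).
by move: (divnK kN); rewrite divnS // kN add1n mulnC => ->.
Qed.

Definition mu (n : nat) : int :=
  \prod_(p <- primes n) (if logn p n == 1%N then -1 else 0).

Lemma norm_mu_le1 (n : nat) : `|mu n| <= 1.
Proof.
suff /andP[] : 0 <= `|mu n| <= 1 by [].
rewrite normr_prod; apply: (big_ind (fun z : int => 0 <= z <= 1)) => [|x y|p _].
- by [].
- by move=> /andP[x0 x1] /andP[y0 y1]; rewrite mulr_ge0 // mulr_ile1.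
- by case: ifP.
Qed.

Lemma mu1 : mu 1 = 1.
Proof. by rewrite /mu big_nil. Qed.

Lemma mu_mul_prime (p e : nat) :
  prime p -> (0 < e)%N -> ~~ (p %| e)%N -> mu (p * e) = - mu e.
Proof.
move=> pp e0 pe; have p0 := prime_gt0 pp.
have np : p \notin primes e by rewrite mem_primes (negPf pe) !andbF.
rewrite /mu (perm_big (p :: primes e)) /=; last first.
  apply: uniq_perm; rewrite ?primes_uniq //= ?np ?primes_uniq //.
  by move=> q; rewrite primesM // primes_prime // !inE.
rewrite big_cons lognM // logn_prime // eqxx lognE (negPf pe) !andbF addn0 /=.
rewrite mulN1r; congr (- _); apply: eq_big_seq => q qe.
have qp : q != p by apply: contraNneq np => <-.
by rewrite lognM // logn_prime // (negPf qp).
Qed.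

Lemma mu_mul_prime_dvd (p e : nat) :
  prime p -> (0 < e)%N -> (p %| e)%N -> mu (p * e) = 0.
Proof.
move=> pp e0 pe; have p0 := prime_gt0 pp.
apply/eqP; rewrite /mu prodf_seq_eq0; apply/hasP; exists p.
  by rewrite primesM // primes_prime // !inE eqxx.
rewrite lognM // logn_prime // eqxx.
have : (0 < logn p e)%N by rewrite logn_gt0 mem_primes pp e0.
by case: (logn p e).
Qed.

(** For a prime [p] dividing [n], the divisors [d] prime to [p] cancel against
    the divisors [p * d]; the divisors divisible by [p ^ 2] contribute
    nothing. *)
Lemma sum_mu_dvd (n D : nat) :
  (0 < n <= D)%N -> \sum_(1 <= d < D.+1 | (d %| n)%N) mu d = (n == 1)%N%:R.
Proof.
move=> /andP[n0 nD]; have [->|n1] := eqVneq n 1%N.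
  rewrite big_mkcond big_ltn ?ltnS ?(leq_trans n0 nD) //= mu1 big_nat big1.
    by rewrite addr0.
  by move=> d /andP[d1 _]; rewrite dvdn1; case: eqP => // de; move: d1; rewrite de.
have {}n1 : (1 < n)%N by case: n n0 n1 {nD} => [|[]].
have pp := pdiv_prime n1; have pn := pdiv_dvd n.
move: (pdiv n) pp pn => p pp pn; have p0 := prime_gt0 pp.
rewrite (bigID (fun d => p %| d)%N) /=.
rewrite (eq_bigl (fun d => (p %| d) && (d %| n))%N); last by move=> d; rewrite andbC.
rewrite big_mkcondr sum_multiples //=.
have -> : \sum_(1 <= e < (D %/ p).+1) (if (p * e %| n)%N then mu (p * e) else 0)
   = - \sum_(1 <= e < (D %/ p).+1 | (e %| n)%N && ~~ (p %| e)%N) mu e.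
  rewrite -sumrN [RHS]big_mkcond /= !big_nat; apply: eq_bigr => e /andP[e0 _].
  have [pe|pe] := boolP (p %| e)%N.
    by rewrite andbF mu_mul_prime_dvd // if_same.
  rewrite andbT mu_mul_prime // Gauss_dvd ?pn // prime_coprime //.
rewrite (big_cat_nat _ (n := (D %/ p).+1) (p := D.+1)) ?ltnS ?leq_div //=.
rewrite [X in _ + (_ + X)]big_nat_cond [X in _ + (_ + X)]big1; last first.
  move=> d /andP[/andP[Dd dD] /andP[dn pd]]; exfalso.
  have : (p * d %| n)%N by rewrite Gauss_dvd ?pn // prime_coprime.
  move/(dvdn_leq n0) => /leq_trans/(_ nD).
  by rewrite mulnC -leq_divRL // leqNgt Dd.
by rewrite addr0 addNr.
Qed.

Lemma sum_mu_dvd_intr (R : nzRingType) (n D : nat) : (0 < n <= D)%N ->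
  \sum_(1 <= d < D.+1 | (d %| n)%N) (mu d)%:~R = (n == 1)%N%:R :> R.
Proof.
move/sum_mu_dvd/(congr1 (fun z : int => z%:~R : R)).
by rewrite rmorph_sum rmorph_nat.
Qed.

Lemma sum_totient_divisors (n D : nat) :
  (0 < n <= D)%N -> (\sum_(1 <= d < D.+1 | d %| n) totient d)%N = n.
Proof.
move=> /andP[n0 nD]; rewrite -[RHS]sum_totient_dvd.
rewrite -(big_mkord (fun d => d %| n)%N totient).
rewrite [RHS]big_mkcond [RHS]big_ltn // dvd0n eqn0Ngt n0 /= add0n -big_mkcond.
rewrite [LHS](@big_cat_nat _ _ _ n.+1) //= [X in (_ + X)%N]big_nat_cond.
rewrite [X in (_ + X)%N]big1 ?addn0 // => d /andP[/andP[nd _]].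
by move/(dvdn_leq n0); rewrite leqNgt nd.
Qed.

Lemma totient_le (n : nat) : (totient n <= n)%N.
Proof.
rewrite totient_count_coprime (leq_trans (leq_sum _ (fun i _ => leq_b1 _))) //.
by rewrite sum_nat_const_nat muln1 subn0.
Qed.

(** * Counting coprime pairs *)

Definition coprime_pairs (X Y : nat) : nat :=
  \sum_(1 <= t < X.+1) \sum_(1 <= c < Y.+1) coprime t c.

(** Expand the indicator of [gcdn t c == 1] by [sum_mu_dvd] and count the
    multiples of each [d]. *)
Lemma coprime_pairs_mu (R : comNzRingType) (X Y : nat) :
  (coprime_pairs X Y)%:R =
  \sum_(1 <= d < X.+1) (mu d)%:~R * ((X %/ d)%:R * (Y %/ d)%:R) :> R.
Proof.
have gcdE t c : (0 < t <= X)%N -> (coprime t c)%:R =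
    \sum_(1 <= d < X.+1) (mu d)%:~R * ((d %| t)%N%:R * (d %| c)%N%:R) :> R.
  move=> /andP[t0 tX]; rewrite -[coprime t c]/(gcdn t c == 1)%N.
  rewrite -(@sum_mu_dvd_intr _ _ X); last first.
    by rewrite gcdn_gt0 t0 /= (leq_trans (dvdn_leq t0 (dvdn_gcdl _ _))).
  rewrite big_mkcond; apply: eq_bigr => d _; rewrite dvdn_gcd.
  by do 2!case: (_ %| _)%N; rewrite /= ?mulr1 ?mulr0.
rewrite /coprime_pairs natr_sum.
under eq_big_nat => t tX.
  rewrite natr_sum; under eq_bigr do rewrite gcdE //.
  rewrite exchange_big /=; over.
rewrite exchange_big /=; apply: eq_big_nat => d /andP[d0 _].
under eq_bigr do rewrite -mulr_sumr -mulr_sumr.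
rewrite -mulr_sumr -mulr_suml; congr (_ * _).
by rewrite !divn_count_dvd !natr_sum.
Qed.

(** Off the diagonal, a coprime pair with maximum [m] is [(m, r)] or [(r, m)]
    with [r < m] prime to [m]; the pair [(1, 1)] would be counted twice. *)
Lemma sum_coprime_max (g : nat -> nat) (N : nat) : (0 < N)%N ->
  (\sum_(1 <= a < N.+1) \sum_(1 <= b < N.+1) coprime a b * g (maxn a b) + g 1
   = 2 * \sum_(1 <= m < N.+1) totient m * g m)%N.
Proof.
case: N => // N _; elim: N => [|N IH].
  by rewrite !big_nat1 maxnn coprime1n (_ : totient 1 = 1%N) //; lia.
rewrite big_nat_recr //= [in RHS]big_nat_recr //= mulnDr -IH.
under eq_bigr do rewrite big_nat_recr //=.
rewrite big_split /= [X in (_ + X + _)%N]big_nat_recr //=.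
rewrite /coprime gcdnn /= mul0n addn0 -!/(coprime _ _).
have E b : (1 <= b < N.+2)%N -> maxn b N.+2 = N.+2 by lia.
have tot : (\sum_(1 <= b < N.+2) coprime N.+2 b = totient N.+2)%N.
  by rewrite totient_count_coprime [in RHS]big_ltn // /coprime gcdn0.
rewrite [X in (_ + X + _ + _)%N](_ : _ = totient N.+2 * g N.+2)%N; last first.
  rewrite -tot big_distrl /=; apply: eq_big_nat => b /E ->.
  by rewrite coprime_sym.
rewrite [X in (_ + X + _)%N](_ : _ = totient N.+2 * g N.+2)%N; last first.
  rewrite -tot big_distrl /=; apply: eq_big_nat => b /E bN.
  by rewrite maxnC bN.
lia.
Qed.

(** * Partial sums of zeta *)

Definition harm (R : realType) (n : nat) : R := \sum_(1 <= d < n.+1) d%:R^-1.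

Definition zeta_sum (R : realType) (s n : nat) : R :=
  \sum_(1 <= e < n.+1) e%:R ^- s.

Lemma harm_ge1 (R : realType) (n : nat) : (0 < n)%N -> 1 <= harm R n.
Proof.
move=> n0; rewrite /harm big_ltn // invr1 lerDl big_nat.
by apply: sumr_ge0 => i _; rewrite invr_ge0.
Qed.

Lemma le_harm (R : realType) (m n : nat) : (m <= n)%N -> harm R m <= harm R n.
Proof.
move=> mn; rewrite /harm [leRHS](@big_cat_nat _ _ _ m.+1) //= lerDl.
by apply: sumr_ge0 => i _; rewrite invr_ge0.
Qed.

Lemma harm_le_ln (R : realType) (n : nat) :
  (0 < n)%N -> harm R n <= 1 + ln n%:R.
Proof.
case: n => // n _; elim: n => [|n IH].
  by rewrite /harm big_nat1 invr1 ln1 addr0.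
rewrite /harm big_nat_recr //= -/(harm R n.+1).
have n1 : 0 < n.+1%:R :> R by rewrite ltr0n.
have n2 : 0 < n.+2%:R :> R by rewrite ltr0n.
suff step : n.+2%:R^-1 <= ln n.+2%:R - ln n.+1%:R :> R.
  by apply: le_trans (lerD IH step) _; rewrite -addrA subrKC.
have e : n.+1%:R / n.+2%:R = 1 + - n.+2%:R^-1 :> R.
  by rewrite -(natr1 n.+1) in n2 *; move: n1 n2; set x := n.+1%:R => *; field; lra.
have := @le_ln1Dx R (- n.+2%:R^-1).
rewrite -e ln_div ?posrE // ltrN2 invf_lt1 // ltr1n => /(_ isT).
by rewrite -lerN2 opprB opprK.
Qed.

(** The tail is dominated by the telescoping sum of [1 / (k * (k + 1))]. *)
Lemma zeta_sum_tail (R : realType) (s n m : nat) : (1 < s)%N -> (0 < n)%N ->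
  zeta_sum R s (n + m) <= zeta_sum R s n + n%:R^-1 - (n + m)%:R^-1.
Proof.
move=> s1 n0; elim: m => [|m IH]; first by rewrite addn0; lra.
rewrite addnS /zeta_sum big_nat_recr //=.
rewrite -/(zeta_sum R s (n + m)) -/(zeta_sum R s n).
set k := (n + m)%N in IH *.
have k0 : 0 < k%:R :> R by rewrite ltr0n /k; lia.
suff : k.+1%:R ^- s <= k%:R^-1 - k.+1%:R^-1 :> R.
  by move: IH (k.+1%:R ^- s : R) (k.+1%:R^-1 : R) => IH x y; lra.
apply: (@le_trans _ _ (k.+1%:R ^- 2)).
  rewrite lef_pV2 ?posrE ?exprn_gt0 ?ltr0n // -!natrX ler_nat.
  by rewrite leq_exp2l //; lia.
rewrite -natr1.
have -> : k%:R^-1 - (k%:R + 1)^-1 = (k%:R * (k%:R + 1))^-1 :> R by field; lra.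
rewrite lef_pV2 ?posrE; nra.
Qed.

Lemma zeta_approx (R : realType) (s n : nat) : (1 < s)%N -> (0 < n)%N ->
  0 <= zeta (s%:R : R) - zeta_sum R s n <= n%:R^-1.
Proof.
move=> s1 n0.
have zE : series (fun n : nat => n.+1%:R `^ (- s%:R)) = zeta_sum R s.
  apply/funext => k; rewrite /series /= /zeta_sum big_add1 /=.
  by apply: eq_bigr => i _; rewrite powRN powR_mulrn.
have incr : nondecreasing_seq (zeta_sum R s).
  move=> a b ab; rewrite /zeta_sum [leRHS](@big_cat_nat _ _ _ a.+1) //= lerDl.
  by apply: sumr_ge0 => i _; rewrite invr_ge0 exprn_ge0.
have ub k : zeta_sum R s k <= zeta_sum R s n + n%:R^-1.
  have [kn|nk] := leqP k n.
    by rewrite (le_trans (incr _ _ kn)) // lerDl invr_ge0.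
  rewrite -(subnKC (ltnW nk)) (le_trans (zeta_sum_tail _ _ s1 n0)) //.
  by rewrite lerBlDr lerDl invr_ge0.
have cv : cvgn (zeta_sum R s).
  apply: nondecreasing_is_cvgn => //.
  by exists (zeta_sum R s n + n%:R^-1) => _ [k _ <-].
rewrite /zeta zE subr_ge0 nondecreasing_cvgn_le //= lerBlDl.
by apply: limr_le => //; near=> k; exact: ub.
Unshelve. all: by end_near.
Qed.

Lemma zeta_ge1 (R : realType) (s : nat) : (1 < s)%N -> 1 <= zeta (s%:R : R).
Proof.
move=> s1; have /andP[+ _] := zeta_approx R s1 (ltn0Sn 0).
by rewrite /zeta_sum big_nat1 expr1n invr1 subr_ge0.
Qed.

(** * Mean values of Dirichlet series *)

(** [n < (n %/ k + 1) * k], and the quotient is at least [1]. *)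
Lemma inv_divn_le (R : realType) (n k : nat) : (0 < k <= n)%N ->
  (n %/ k)%:R^-1 <= 2 * k%:R / n%:R :> R.
Proof.
move=> /andP[k0 kn]; have n0 : (0 < n)%N by lia.
have q0 : (0 < n %/ k)%N by rewrite divn_gt0.
rewrite -[leLHS]mul1r ler_pdivrMr ?ltr0n // mulrAC ler_pdivlMr ?ltr0n //.
rewrite mul1r -!natrM ler_nat.
have := ltn_ceil n k0; nia.
Qed.

(** Both sides are the sum of [g d / (d * e) ^ s] over [d * e <= N]. *)
Lemma sum_zeta_sum_divn (R : realType) (s : nat) (g : nat -> R) (N : nat) :
  \sum_(1 <= d < N.+1) g d / d%:R ^+ s * zeta_sum R s (N %/ d) =
  \sum_(1 <= n < N.+1) n%:R ^- s * \sum_(1 <= d < N.+1 | (d %| n)%N) g d.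
Proof.
under [RHS]eq_bigr do rewrite mulr_sumr big_mkcond.
rewrite exchange_big /=; apply: eq_big_nat => d /andP[d0 _].
rewrite -big_mkcond /= sum_multiples // mulr_sumr; apply: eq_bigr => e _.
by rewrite natrM exprMn invfM [RHS]mulrC mulrA.
Qed.

(** Replacing [zeta_sum s (N %/ d)] by its limit costs [2 d / N], and the
    weights are at most [d ^ -2], so the errors add up to a harmonic sum. *)
Lemma zeta_mul_sum_approx (R : realType) (s : nat) (g : nat -> R) (N : nat) :
  (1 < s)%N -> (0 < N)%N ->
  (forall d, (0 < d)%N -> `|g d / d%:R ^+ s| <= d%:R ^- 2) ->
  `|zeta s%:R * (\sum_(1 <= d < N.+1) g d / d%:R ^+ s) -
    \sum_(1 <= n < N.+1) n%:R ^- s * \sum_(1 <= d < N.+1 | (d %| n)%N) g d|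
  <= 2 * harm R N / N%:R.
Proof.
move=> s1 N0 gle; rewrite -sum_zeta_sum_divn mulr_sumr -sumrB.
apply: le_trans (ler_norm_sum _ _ _) _.
rewrite /harm mulr_sumr mulr_suml !big_nat; apply: ler_sum => d /andP[d0 dN].
rewrite mulrC -mulrBr normrM.
have q0 : (0 < N %/ d)%N by rewrite divn_gt0.
have /andP[z0 z1] := zeta_approx R s1 q0.
rewrite (ger0_norm z0).
apply: le_trans (ler_pM _ _ (gle d d0) z1) _; rewrite ?normr_ge0 //.
apply: le_trans (ler_wpM2l _ (inv_divn_le _ _)) _.
- by rewrite invr_ge0 exprn_ge0.
- by rewrite d0.
- by rewrite le_eqVlt; apply/orP; left; apply/eqP; field; rewrite !pnatr_eq0; lia.
Qed.

Lemma sum_mu_approx (R : realType) (N : nat) : (0 < N)%N ->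
  `|(zeta (2 : R))^-1 - \sum_(1 <= d < N.+1) (mu d)%:~R / d%:R ^+ 2|
  <= 2 * harm R N / N%:R.
Proof.
move=> N0; have z1 : 1 <= zeta (2 : R) by exact: (@zeta_ge1 R 2).
have := @zeta_mul_sum_approx R 2 (fun d => (mu d)%:~R) N isT N0.
set A := \sum_(1 <= d < N.+1) _; rewrite [X in _ - X](_ : _ = 1); last first.
  under eq_big_nat => n nN.
    rewrite sum_mu_dvd_intr //; over.
  rewrite big_ltn //= expr1n invr1 mul1r big_nat big1 ?addr0 // => n /andP[n1 _].
  by rewrite gtn_eqF // mulr0.
set z := zeta _ in z1 *; move=> H.
have {}H : `|z * A - 1| <= 2 * harm R N / N%:R.
  apply: H => d d0; rewrite normrM normfV normrX normr_nat.
  rewrite ler_piMl ?invr_ge0 ?exprn_ge0 // -intr_norm.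
  by rewrite -[leRHS]/(1%:~R) ler_int norm_mu_le1.
have -> : z^-1 - A = - (z^-1 * (z * A - 1)) by field; lra.
rewrite normrN normrM; apply: le_trans H; rewrite ler_piMl // ger0_norm.
  by rewrite invf_le1; lra.
by rewrite invr_ge0; lra.
Qed.

Lemma sum_totient_approx (R : realType) (N : nat) : (0 < N)%N ->
  `|zeta (2 : R) / zeta 3 - \sum_(1 <= m < N.+1) (totient m)%:R / m%:R ^+ 3|
  <= 3 * harm R N / N%:R.
Proof.
move=> N0; have z1 : 1 <= zeta (3 : R) by exact: (@zeta_ge1 R 3).
have := @zeta_mul_sum_approx R 3 (fun d => (totient d)%:R) N isT N0.
set A := \sum_(1 <= d < N.+1) _.
rewrite [X in _ - X](_ : _ = zeta_sum R 2 N); last first.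
  apply: eq_big_nat => n nN; have n0 : (0 < n)%N by case/andP: nN.
  rewrite -(natr_sum _ _ _ (fun d => totient d)) /= (@sum_totient_divisors n N) //.
  by field; rewrite pnatr_eq0; lia.
set z := zeta _ in z1 *; move=> H.
have {}H : `|z * A - zeta_sum R 2 N| <= 2 * harm R N / N%:R.
  apply: H => d d0; rewrite normrM normfV normrX normr_nat.
  rewrite ger0_norm // ler_pdivrMr ?exprn_gt0 ?ltr0n //.
  have -> : d%:R ^- 2 * d%:R ^+ 3 = d%:R :> R by field; rewrite pnatr_eq0; lia.
  by rewrite ler_nat totient_le.
have /andP[z20 z21] : 0 <= zeta (2 : R) - zeta_sum R 2 N <= N%:R^-1.
  exact: (@zeta_approx R 2 N).
have -> : zeta 2 / z - A =
    z^-1 * ((zeta 2 - zeta_sum R 2 N) - (z * A - zeta_sum R 2 N)).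
  by field; lra.
have zi : `|z^-1| <= 1.
  by rewrite ger0_norm ?invf_le1 ?invr_ge0; lra.
rewrite normrM; apply: le_trans (ler_piMl _ zi) _ => //.
apply: le_trans (ler_normB _ _) _; rewrite (ger0_norm z20).
apply: le_trans (lerD z21 H) _.
rewrite -[X in X + _ <= _]mul1r -mulrDl ler_wpM2r ?invr_ge0 //.
by have := harm_ge1 R N0; lra.
Qed.

(** * Asymptotics of the counting functions *)

Lemma divn_floor (R : realType) (n k : nat) : (0 < k)%N ->
  n%:R / k%:R - 1 <= ((n %/ k)%:R : R) <= n%:R / k%:R.
Proof.
move=> k0; rewrite lerBlDr !(ler_pdivrMr, ler_pdivlMr) ?ltr0n //.
rewrite natr1 -!natrM !ler_nat leq_divM andbT ltnW //.
by rewrite ltn_ceil.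
Qed.

(** In the Moebius formula both integral parts are replaced by the quotients
    themselves; for each [d] this costs at most [2 * T / (m * d)]. Then the
    truncated sum of [mu d / d ^ 2] is replaced by [1 / zeta 2], at a relative
    cost of the order of [m ^ 2 / T] times the harmonic sum. *)
Lemma coprime_pairs_approx (R : realType) (T m : nat) : (0 < m)%N ->
  (m ^ 2 <= T)%N ->
  `|(coprime_pairs (T %/ m ^ 2) (T %/ m))%:R - T%:R ^+ 2 / m%:R ^+ 3 / zeta 2|
  <= 6 * (T%:R / m%:R) * harm R T.
Proof.
move=> m0 mT; rewrite coprime_pairs_mu.
set X := (T %/ m ^ 2)%N.
have T0 : (0 < T)%N by nia.
have X0 : (0 < X)%N by rewrite divn_gt0 ?expn_gt0 ?m0.
have XT : (X <= T)%N by exact: leq_div.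
have mR : 0 < m%:R :> R by rewrite ltr0n.
have TR : 0 < T%:R :> R by rewrite ltr0n.
set A := \sum_(1 <= d < X.+1) (mu d)%:~R / d%:R ^+ 2 : R.
have e1 : `|\sum_(1 <= d < X.+1) (mu d)%:~R * ((X %/ d)%:R * (T %/ m %/ d)%:R)
   - T%:R ^+ 2 / m%:R ^+ 3 * A| <= 2 * (T%:R / m%:R) * harm R X.
  rewrite mulr_sumr -sumrB; apply: le_trans (ler_norm_sum _ _ _) _.
  rewrite /harm mulr_sumr !big_nat; apply: ler_sum => d /andP[d0 dX].
  have dR : 1 <= d%:R :> R by rewrite ler1n.
  have m1 : 1 <= m%:R :> R by rewrite ler1n.
  have -> : T%:R ^+ 2 / m%:R ^+ 3 * ((mu d)%:~R / d%:R ^+ 2) = (mu d)%:~R *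
     (T%:R / (m%:R ^+ 2 * d%:R) * (T%:R / (m%:R * d%:R))) :> R.
    by field; lra.
  rewrite -mulrBr normrM.
  have m1n : `|(mu d)%:~R| <= 1 :> R.
    by rewrite -intr_norm -[leRHS]/(1%:~R) ler_int norm_mu_le1.
  apply: le_trans (ler_piMl _ m1n) _ => //.
  have dm2 : (0 < m ^ 2 * d)%N by rewrite muln_gt0 expn_gt0 m0 d0.
  have dm : (0 < m * d)%N by rewrite muln_gt0 m0 d0.
  have := divn_floor R T dm2; have := divn_floor R T dm.
  rewrite -!divnMA (natrM _ (m ^ 2)) natrX (natrM _ m).
  have : 0 <= (T %/ (m * d))%:R :> R by [].
  have : 0 <= (T %/ (m ^ 2 * d))%:R :> R by [].
  set u' := (T %/ (m ^ 2 * d))%:R; set v' := (T %/ (m * d))%:R.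
  set v := T%:R / (m%:R * d%:R).
  have -> : T%:R / (m%:R ^+ 2 * d%:R) = v / m%:R :> R by rewrite /v; field; lra.
  have -> : 2 * (T%:R / m%:R) * d%:R^-1 = 2 * v by rewrite /v; field; lra.
  have v0 : 0 <= v by rewrite /v divr_ge0 // mulr_ge0 //; lra.
  have : v / m%:R <= v by rewrite ler_pdivrMr // ler_peMr.
  set u := v / m%:R => uv u0' v0' /andP[v1 v2] /andP[u1 u2].
  rewrite distrC ger0_norm; nra.
have e2 := @sum_mu_approx R X X0; rewrite -/A in e2.
have hX : harm R X <= harm R T by exact: le_harm.
have h1 : 1 <= harm R T by exact: harm_ge1.
have q : `|T%:R ^+ 2 / m%:R ^+ 3 * (zeta 2)^-1 - T%:R ^+ 2 / m%:R ^+ 3 * A| <=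
   4 * (T%:R / m%:R) * harm R T.
  rewrite -mulrBr normrM ger0_norm ?divr_ge0 ?exprn_ge0 //.
  have iX : X%:R^-1 <= 2 * m%:R ^+ 2 / T%:R :> R.
    have := @inv_divn_le R T (m ^ 2); rewrite natrX; apply.
    by rewrite expn_gt0 m0.
  have e3 : 2 * harm R X / X%:R <= 2 * harm R T * (2 * m%:R ^+ 2 / T%:R).
    apply: ler_pM => //; last by lra.
      by have := harm_ge1 R X0; lra.
  apply: le_trans (ler_wpM2l _ (le_trans e2 e3)) _.
    by rewrite divr_ge0 ?exprn_ge0.
  by rewrite le_eqVlt; apply/orP; left; apply/eqP; field; lra.
have e4 : 2 * (T%:R / m%:R) * harm R X <= 2 * (T%:R / m%:R) * harm R T.
  by rewrite ler_wpM2l // mulr_ge0 // divr_ge0.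
rewrite distrC in q.
move: e1 q e4; set P := \sum_(_ <= _ < _) _; set Q := _ * A.
set U := T%:R ^+ 2 / m%:R ^+ 3 * (zeta 2)^-1.
have -> : P - U = (P - Q) + (Q - U) by lra.
move=> e1 q e4; apply: le_trans (ler_normD _ _) _; lra.
Qed.

(** The first error term comes from [coprime_pairs_approx], where
    [totient m <= m] cancels the [m] in the denominator; the second is the tail
    of the series for [zeta 2 / zeta 3]; the third is the error in
    [coprime_pairs T T]. *)
Lemma weighted_pairs_approx (R : realType) (T M : nat) : (0 < M)%N ->
  (M ^ 2 <= T)%N ->
  `|48 * \sum_(1 <= m < M.+1)
      (totient m)%:R * (coprime_pairs (T %/ m ^ 2) (T %/ m))%:R
    - 12 * (coprime_pairs T T)%:R - (48 / zeta 3 - 12 / zeta 2) * T%:R ^+ 2|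
  <= (288 * (M%:R * T%:R) + 144 * (T%:R ^+ 2 / M%:R) + 72 * T%:R) * harm R T.
Proof.
move=> M0 MT.
have T0 : (0 < T)%N by nia.
have MleT : (M <= T)%N by nia.
have MR : 0 < M%:R :> R by rewrite ltr0n.
have z2 : 1 <= zeta (2 : R) by exact: (@zeta_ge1 R 2).
have z3 : 1 <= zeta (3 : R) by exact: (@zeta_ge1 R 3).
have h1 : 1 <= harm R T by exact: harm_ge1.
have TR : 0 < T%:R :> R by rewrite ltr0n.
have e0 := @coprime_pairs_approx R T 1 isT T0.
rewrite exp1n !divn1 !expr1n !divr1 in e0.
set S := \sum_(_ <= _ < _) _.
set L := \sum_(1 <= m < M.+1) (totient m)%:R / m%:R ^+ 3 : R.
have e1 : `|S - T%:R ^+ 2 / zeta 2 * L| <= 6 * (M%:R * T%:R) * harm R T.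
  rewrite mulr_sumr -sumrB; apply: le_trans (ler_norm_sum _ _ _) _.
  have -> : 6 * (M%:R * T%:R) * harm R T =
      \sum_(1 <= m < M.+1) 6 * T%:R * harm R T.
    by rewrite sumr_const_nat subSS subn0 -[RHS]mulr_natr; ring.
  rewrite !big_nat; apply: ler_sum => m /andP[m0 mM].
  have m1 : 1 <= m%:R :> R by rewrite ler1n.
  have -> : T%:R ^+ 2 / zeta 2 * ((totient m)%:R / m%:R ^+ 3) = 
    (totient m)%:R * (T%:R ^+ 2 / m%:R ^+ 3 / zeta 2) :> R by field; lra.
  rewrite -mulrBr normrM ger0_norm //.
  have mT : (m ^ 2 <= T)%N by nia.
  have tm : (totient m)%:R <= m%:R :> R.
    by rewrite ler_nat totient_le.
  apply: le_trans (ler_pM _ _ tm (@coprime_pairs_approx R T m m0 mT)) _ => //.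
  by rewrite le_eqVlt; apply/orP; left; apply/eqP; field; lra.
have e2 : `|T%:R ^+ 2 / zeta 2 * L - T%:R ^+ 2 / zeta 3| <=
    3 * (T%:R ^+ 2 / M%:R) * harm R T.
  have -> : T%:R ^+ 2 / zeta 2 * L - T%:R ^+ 2 / zeta 3 =
    - (T%:R ^+ 2 / zeta 2 * (zeta 2 / zeta 3 - L)) by field; lra.
  rewrite normrN normrM ger0_norm; last by rewrite divr_ge0 ?exprn_ge0; lra.
  have T2 : T%:R ^+ 2 / zeta 2 <= T%:R ^+ 2 :> R.
    by rewrite ler_pdivrMr ?ler_peMr ?exprn_ge0; lra.
  apply: le_trans (ler_pM _ _ T2 (sum_totient_approx R M0)) _ => //.
    by rewrite divr_ge0 ?exprn_ge0; lra.
  have -> : T%:R ^+ 2 * (3 * harm R M / M%:R) =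
    3 * (T%:R ^+ 2 / M%:R) * harm R M by field; lra.
  by rewrite ler_wpM2l ?le_harm // mulr_ge0 // divr_ge0 ?exprn_ge0.
set c := (coprime_pairs T T)%:R in e0 *.
have -> : 48 * S - 12 * c - (48 / zeta 3 - 12 / zeta 2) * T%:R ^+ 2 =
  48 * (S - T%:R ^+ 2 / zeta 2 * L) +
  48 * (T%:R ^+ 2 / zeta 2 * L - T%:R ^+ 2 / zeta 3) -
  12 * (c - T%:R ^+ 2 / zeta 2) by ring.
apply: le_trans (ler_normB _ _) _.
rewrite [ `|12 * _| ]normrM normr_nat.
apply: le_trans (lerD (ler_normD _ _) (lexx _)) _.
rewrite ![ `|48 * _| ]normrM !normr_nat; lra.
Qed.

(** * Integer vectors and projective points *)

(** The indices [i + 1] and [i + 2] are taken modulo 3, so that the vanishing of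
    any of the three coordinates can be treated at once. *)
Definition mk3 (i : 'I_3) (p q r : int) : 'rV[int]_3 :=
  \row_l (if l == i then p else if l == i + 1 then q else r).

Lemma ord3_cases (i l : 'I_3) : [\/ l = i, l = i + 1 | l = i + 2].
Proof.
suff : [|| l == i, l == i + 1 | l == i + 2].
  by move=> /or3P[] /eqP ->; [apply: Or31|apply: Or32|apply: Or33].
by move: i l => [[|[|[|?]]] ?] [[|[|[|?]]] ?].
Qed.

Lemma ord3_neq (i : 'I_3) :
  [/\ (i + 1 == i) = false, (i + 2 == i) = false & (i + 2 == i + 1) = false].
Proof. by case: i => [[|[|[|]]] ?]; split. Qed.

Lemma big_ord3 (T : Type) (idx : T) (op : Monoid.com_law idx) (F : 'I_3 -> T)
    (i : 'I_3) :
  \big[op/idx]_(l < 3) F l = op (F i) (op (F (i + 1)) (F (i + 2))).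
Proof.
have [n1 n2 n3] := ord3_neq i.
rewrite (bigD1 i) //= (bigD1 (i + 1)) /= ?n1 // (bigD1 (i + 2)) /= ?n2 ?n3 //.
rewrite big1 ?Monoid.mulm1 // => l.
by case: (ord3_cases i l) => ->; rewrite eqxx ?andbF.
Qed.

Lemma mk3_coords (i : 'I_3) (p q r : int) :
  [/\ mk3 i p q r ord0 i = p, mk3 i p q r ord0 (i + 1) = q &
      mk3 i p q r ord0 (i + 2) = r].
Proof. by have [n1 n2 n3] := ord3_neq i; rewrite !mxE !eqxx n1 n2 n3. Qed.

Lemma mk3_eta (i : 'I_3) (x : 'rV[int]_3) :
  x = mk3 i (x ord0 i) (x ord0 (i + 1)) (x ord0 (i + 2)).
Proof.
have [n1 n2 n3] := ord3_neq i.
apply/rowP => l; rewrite (ord1 0) mxE.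
by case: (ord3_cases i l) => ->; rewrite ?eqxx ?n1 ?n2 ?n3.
Qed.

Lemma mk3_inj (i : 'I_3) (p q r p' q' r' : int) :
  mk3 i p q r = mk3 i p' q' r' -> [/\ p = p', q = q' & r = r'].
Proof.
move=> e; have [x0 x1 x2] := mk3_coords i p q r.
have [y0 y1 y2] := mk3_coords i p' q' r'.
rewrite e in x0 x1 x2; by rewrite -x0 -x1 -x2 y0 y1 y2.
Qed.

Lemma mk3_rot (i : 'I_3) (p q r : int) : mk3 i p q r = mk3 (i + 1) q r p.
Proof.
apply/rowP => l; rewrite !mxE.
by move: i l => [[|[|[|?]]] ?] [[|[|[|?]]] ?].
Qed.

Lemma mk3N (i : 'I_3) (p q r : int) : - mk3 i p q r = mk3 i (- p) (- q) (- r).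
Proof. by apply/rowP => l; rewrite !mxE; case: ifP => // _; case: ifP. Qed.

Lemma maxnorm_mk3 (i : 'I_3) (p q r : int) :
  maxnorm (mk3 i p q r) = maxn `|p| (maxn `|q| `|r|).
Proof.
by rewrite /maxnorm (big_ord3 _ _ i) /=; have [-> -> ->] := mk3_coords i p q r.
Qed.

Lemma primitive_mk3 (i : 'I_3) (p q r : int) :
  primitive (mk3 i p q r) <-> gcdn `|p| (gcdn `|q| `|r|) = 1%N.
Proof.
rewrite /primitive.
have -> (x : 'rV[int]_3) : \big[gcdz/0]_(l < 3) x ord0 l
    = (\big[gcdn/0%N]_(l < 3) `|x ord0 l|%N)%:Z.
  by rewrite !big_ord_recl !big_ord0.
rewrite (big_ord3 _ _ i) /=; have [-> -> ->] := mk3_coords i p q r.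
by split=> [[]|->].
Qed.

Lemma primitiveN (x : 'rV[int]_3) : primitive x -> primitive (- x).
Proof.
rewrite (mk3_eta ord0 x) mk3N => /primitive_mk3 xp.
by apply/primitive_mk3; rewrite !abszN.
Qed.

Lemma primitive_neq0 (x : 'rV[int]_3) : primitive x -> x != 0.
Proof.
rewrite (mk3_eta ord0 x) => /primitive_mk3 xp; apply/eqP => x0.
by move: xp; rewrite (mk3_eta ord0 x) x0 !mxE.
Qed.

Definition dot (x y : 'rV[int]_3) : int := \sum_(i < 3) x ord0 i * y ord0 i.

Lemma dot_mk3 (i : 'I_3) (p q r p' q' r' : int) :
  dot (mk3 i p q r) (mk3 i p' q' r') = p * p' + (q * q' + r * r').
Proof.
rewrite /dot (big_ord3 _ _ i) /=; have [-> -> ->] := mk3_coords i p q r.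
by have [-> -> ->] := mk3_coords i p' q' r'.
Qed.

Lemma dotC (x y : 'rV[int]_3) : dot x y = dot y x.
Proof. by apply: eq_bigr => i _; rewrite mulrC. Qed.

Lemma dim_line (u : 'rV[rat]_3) : u != 0 -> \dim <[u]>%VS == 1%N.
Proof. by move=> u0; rewrite dim_vline u0. Qed.

Lemma unit_row_neq0 : (const_mx 1 : 'rV[rat]_3) != 0.
Proof. by apply/eqP => /rowP/(_ ord0); rewrite !mxE. Qed.

(** Only meaningful for nonzero [x]; the default value is arbitrary. *)
Definition toP (x : 'rV[int]_3) : P2Q :=
  insubd (exist (fun L : {vspace 'rV[rat]_3} => \dim L == 1%N) _
            (dim_line unit_row_neq0)) <[map_mx intr x]>%VS.

Lemma map_intr_eq0 (x : 'rV[int]_3) :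
  (map_mx intr x == 0 :> 'rV[rat]_3) = (x == 0).
Proof.
apply/eqP/eqP => [/rowP x0|->]; last by apply/rowP => i; rewrite !mxE.
by apply/rowP => i; have := x0 i; rewrite !mxE => /eqP; rewrite intr_eq0 => /eqP.
Qed.

Lemma represents_toP (x : 'rV[int]_3) : primitive x -> represents x (toP x).
Proof.
move=> px; split=> //; split; first by rewrite map_intr_eq0 primitive_neq0.
by rewrite insubdK //; apply: dim_line; rewrite map_intr_eq0 primitive_neq0.
Qed.

Lemma toPK (x : 'rV[int]_3) (P : P2Q) : represents x P -> toP x = P.
Proof.
move=> [px [_ xP]]; apply: val_inj; rewrite -xP.
by have [_ [_ ->]] := represents_toP px.
Qed.

Lemma representsN (x : 'rV[int]_3) (P : P2Q) :
  represents x P -> represents (- x) P.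
Proof.
move=> [px xP]; split; first exact: primitiveN.
rewrite (_ : map_mx intr (- x) = (-1) *: map_mx intr x :> 'rV[rat]_3).
  exact: scale_hom_coords.
by apply/rowP => i; rewrite !mxE rmorphN mulN1r.
Qed.

Definition eqpm (x y : 'rV[int]_3) : Prop := x = y \/ x = - y.

Lemma eqpm_toP (x y : 'rV[int]_3) :
  primitive x -> primitive y -> toP x = toP y -> eqpm x y.
Proof.
move=> px py xy; apply: (@represents_uniq x y (toP x)).
- exact: represents_toP.
- by rewrite xy; exact: represents_toP.
Qed.

Lemma toP_eqpm (x y : 'rV[int]_3) (P : P2Q) :
  represents x P -> eqpm y x -> toP y = P.
Proof. by move=> xP [->|->]; apply: toPK => //; exact: representsN. Qed.

(** Orthogonality and the vanishing of a coordinate are invariant under scaling,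
    so one pair of representatives decides. *)
Lemma boundary_represents (x y : 'rV[int]_3) (p : P2Q * P2Q) :
  represents x p.1 -> represents y p.2 ->
  ((VQ `\` UQ)%classic p <->
   dot x y = 0 /\ exists i, x ord0 i = 0 \/ y ord0 i = 0).
Proof.
move=> [_ xP] [_ yP].
have VE : VQ p <-> dot x y = 0.
  split=> [/(_ _ _ xP yP) H|xy u v uP vP].
    apply: (@intr_inj rat); rewrite rmorph0 -H rmorph_sum; apply: eq_bigr => i _.
    by rewrite !mxE rmorphM.
  have [a _ ->] := hom_coords_scale xP uP; have [b _ ->] := hom_coords_scale yP vP.
  transitivity (a * b * (dot x y)%:~R); last by rewrite xy mulr0.
  rewrite rmorph_sum mulr_sumr; apply: eq_bigr => i _.
  by rewrite !mxE rmorphM /= mulrACA.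
split=> [[Vp nU]|[xy [i xyi]]].
  split; first exact/VE.
  apply: contrapT => nz; apply: nU; split=> // u v uP vP i.
  have [a a0 ->] := hom_coords_scale xP uP.
  have [b b0 ->] := hom_coords_scale yP vP.
  rewrite !mxE !mulf_eq0 !negb_or a0 b0 !intr_eq0 /=.
  by split; apply/eqP => z; apply: nz; exists i; [left|right].
split; first exact/VE.
move=> [_ /(_ _ _ xP yP i)]; rewrite !mxE !intr_eq0.
by case: xyi => ->; rewrite eqxx; case.
Qed.

(** * Parametrisation of the boundary *)

Definition signed (s : bool) (n : nat) : int := (-1) ^+ s * n%:Z.

(** [par_x] and [par_y] are the general form of two orthogonal vectors the first
    of which vanishes at [i], up to the signs of the vectors. The parameters are
    natural numbers, and signs are carried by booleans. *)
Definition par_x (i : 'I_3) (s : bool) (a b : nat) : 'rV[int]_3 :=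
  mk3 i 0 a (signed s b).

Definition par_y (i : 'I_3) (s s' : bool) (a b t c : nat) : 'rV[int]_3 :=
  mk3 i (signed s' c) (t%:Z * signed s b) (- (t%:Z * a%:Z)).

(** [w] tells which of the two factors carries the coordinate known to
    vanish. *)
Definition par_point (w : bool) (i : 'I_3) (s s' : bool) (a b t c : nat) :
  P2Q * P2Q :=
  let P := toP (par_x i s a b) in let Q := toP (par_y i s s' a b t c) in
  if w then (P, Q) else (Q, P).

(** For [t = 0] the vector [par_y] is a unit vector, whose sign [s'] does not
    affect the point and has to be fixed. *)
Definition generic (T : nat) (s' : bool) (a b t c : nat) : bool :=
  [&& coprime a b, coprime t c, (0 < a)%N, (0 < b)%N, (0 < c)%N,
      (t == 0%N) ==> ~~ s' & (maxn a b * maxn c (t * maxn a b) <= T)%N].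

Lemma abs_signed (s : bool) (n : nat) : `|signed s n|%N = n.
Proof. by rewrite /signed abszMsign. Qed.

Lemma abs_mul_signed (t : nat) (s : bool) (n : nat) :
  absz (t%:Z * signed s n)%R = (t * n)%N.
Proof. by rewrite abszM abs_signed. Qed.

Lemma maxnorm_par_x (i : 'I_3) (s : bool) (a b : nat) :
  maxnorm (par_x i s a b) = maxn a b.
Proof. by rewrite maxnorm_mk3 abs_signed max0n. Qed.

Lemma maxnorm_par_y (i : 'I_3) (s s' : bool) (a b t c : nat) :
  maxnorm (par_y i s s' a b t c) = maxn c (t * maxn a b).
Proof.
rewrite maxnorm_mk3 abszN abs_mul_signed abszM abs_signed maxnMr.
by rewrite [maxn (t * b)%N _]maxnC.
Qed.

Lemma primitive_par_x (i : 'I_3) (s : bool) (a b : nat) :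
  coprime a b -> primitive (par_x i s a b).
Proof. by move=> /eqP ab; apply/primitive_mk3; rewrite abs_signed gcd0n. Qed.

Lemma primitive_par_y (i : 'I_3) (s s' : bool) (a b t c : nat) :
  coprime a b -> coprime t c -> primitive (par_y i s s' a b t c).
Proof.
move=> /eqP ab /eqP tc; apply/primitive_mk3.
rewrite abszN abs_mul_signed abszM abs_signed -muln_gcdr [gcdn b a]gcdnC.
by rewrite ab muln1 gcdnC.
Qed.

Lemma dot_par (i : 'I_3) (s s' : bool) (a b t c : nat) :
  dot (par_x i s a b) (par_y i s s' a b t c) = 0.
Proof. by rewrite dot_mk3; ring. Qed.

Lemma par_point_represents (w : bool) (i : 'I_3) (s s' : bool) (a b t c : nat) :
  coprime a b -> coprime t c ->
  let p := par_point w i s s' a b t c in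
  represents (par_x i s a b) (if w then p.1 else p.2) /\
  represents (par_y i s s' a b t c) (if w then p.2 else p.1).
Proof.
move=> ab tc.
have rx := represents_toP (primitive_par_x i s ab).
have ry := represents_toP (primitive_par_y i s s' ab tc).
by rewrite /par_point; case: w.
Qed.

(** [T] stands for the integral part of [sqrt B]. *)
Definition boundary (T : nat) : set (P2Q * P2Q) :=
  [set p | (VQ `\` UQ)%classic p /\
           (maxnorm (prim_rep p.1) * maxnorm (prim_rep p.2) <= T)%N]%classic.

Lemma par_point_boundary (T : nat) (w : bool) (i : 'I_3) (s s' : bool)
    (a b t c : nat) :
  generic T s' a b t c -> boundary T (par_point w i s s' a b t c).
Proof.
case/and5P=> ab tc _ _ /and3P[_ _ hT].
have [] := par_point_represents w i s s' ab tc.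
move=> rx ry.
have zi : par_x i s a b ord0 i = 0 by case: (mk3_coords i 0 a (signed s b)).
have := maxnorm_represents rx; have := maxnorm_represents ry.
rewrite maxnorm_par_x maxnorm_par_y => my mx.
case: w rx ry my mx => rx ry my mx; split; rewrite ?mx ?my // 1?mulnC //.
- by apply/(boundary_represents rx ry); rewrite dot_par; split=> //; exists i; left.
- by apply/(boundary_represents ry rx); rewrite dotC dot_par; split=> //; exists i; right.
Qed.

Definition zeros (x : 'rV[int]_3) : nat := \sum_(i < 3) (x ord0 i == 0).

Lemma zeros_mk3 (i : 'I_3) (p q r : int) :
  zeros (mk3 i p q r) = ((p == 0) + ((q == 0) + (r == 0)))%N.
Proof.
by rewrite /zeros (big_ord3 _ _ i) /=; have [-> -> ->] := mk3_coords i p q r.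
Qed.

Lemma eqpm_zeros (x y : 'rV[int]_3) : eqpm x y -> zeros x = zeros y.
Proof. by case=> -> //; apply: eq_bigr => i _; rewrite mxE oppr_eq0. Qed.

Lemma signed_eq0 (s : bool) (n : nat) : (signed s n == 0) = (n == 0%N).
Proof. by rewrite -absz_eq0 abs_signed. Qed.

Lemma zeros_par_x (i : 'I_3) (s : bool) (a b : nat) :
  (0 < a)%N -> (0 < b)%N -> zeros (par_x i s a b) = 1%N.
Proof. by move=> a0 b0; rewrite zeros_mk3 signed_eq0 eqz_nat; lia. Qed.

Lemma zeros_par_y (i : 'I_3) (s s' : bool) (a b t c : nat) :
  (0 < a)%N -> (0 < b)%N -> (0 < c)%N -> zeros (par_y i s s' a b t c) != 1%N.
Proof.
move=> a0 b0 c0; rewrite zeros_mk3 oppr_eq0 !(mulf_eq0 t%:Z) !signed_eq0 !eqz_nat.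
by case: t => [|t]; lia.
Qed.

Lemma par_x_eqpm (i i' : 'I_3) (s r : bool) (a b a' b' : nat) :
  (0 < a)%N -> (0 < b)%N -> (0 < a')%N -> (0 < b')%N ->
  eqpm (par_x i s a b) (par_x i' r a' b') -> [/\ i = i', s = r, a = a' & b = b'].
Proof.
move=> a0 b0 a0' b0' e.
have ii : i = i'.
  have z : par_x i' r a' b' ord0 i = 0.
    have : par_x i s a b ord0 i = 0 by case: (mk3_coords i 0 a (signed s b)).
    by case: e => ->; rewrite // mxE => /eqP; rewrite oppr_eq0 => /eqP.
  have [_ y1 y2] := mk3_coords i' 0 a' (signed r b').
  case: (ord3_cases i' i) => // ii; move: z; rewrite ii /par_x ?y1 ?y2 => /eqP.
  - by rewrite eqz_nat => /eqP; lia.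
  - by rewrite signed_eq0 => /eqP; lia.
move: e; rewrite -ii /eqpm /par_x mk3N /signed.
by case=> /mk3_inj[_]; case: s; case: r; rewrite /= ?expr1 ?expr0; split=> //; lia.
Qed.

(** The last coordinate gives [t] and the first one [c]. If [t] is positive the
    two vectors have the same last coordinate, hence are equal and not
    opposite. *)
Lemma par_y_eqpm (i : 'I_3) (s s' r' : bool) (a b t c t' c' : nat) :
  (0 < a)%N -> (0 < b)%N -> (0 < c)%N -> coprime t c -> coprime t' c' ->
  (t == 0%N) ==> ~~ s' -> (t' == 0%N) ==> ~~ r' ->
  eqpm (par_y i s s' a b t c) (par_y i s r' a b t' c') ->
  [/\ s' = r', t = t' & c = c'].
Proof.
move=> a0 b0 c0 tc tc' s0 r0; rewrite /eqpm /par_y mk3N => e.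
have tt : t = t'.
  case: e => /mk3_inj[_ _]; nia.
rewrite -tt in tc' r0 e *.
have cc : c = c'.
  by case: e => /mk3_inj[/(congr1 absz) + _ _]; rewrite ?abszN !abs_signed.
split=> //; rewrite -cc in e *.
have [t0|t0] := posnP t.
  by move: s0 r0 {e}; rewrite t0 /=; case: s'; case: r'.
case: e => /mk3_inj[+ _]; last by nia.
by rewrite /signed; case: s' s0; case: r' r0; rewrite /= ?expr1 ?expr0; lia.
Qed.

(** Zero coordinates are counted to recover [w]: the vector [par_x] has exactly
    one of them, [par_y] has none or two. *)
Lemma par_point_inj (T : nat) (w v : bool) (i j : 'I_3) (s s' r r' : bool)
    (a b t c a' b' t' c' : nat) :
  generic T s' a b t c -> generic T r' a' b' t' c' ->
  par_point w i s s' a b t c = par_point v j r r' a' b' t' c' ->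
  [/\ w = v, i = j, s = r & s' = r'] /\ [/\ a = a', b = b', t = t' & c = c'].
Proof.
case/and5P=> ab tc a0 b0 /and3P[c0 s0 _].
case/and5P=> ab' tc' a0' b0' /and3P[c0' r0 _] E.
have px := primitive_par_x i s ab; have py := primitive_par_y i s s' ab tc.
have px' := primitive_par_x j r ab'; have py' := primitive_par_y j r r' ab' tc'.
have wv : w = v.
  apply/eqP; apply/negPn/negP => wv.
  have : toP (par_x i s a b) = toP (par_y j r r' a' b' t' c').
    by move: E wv; rewrite /par_point; case: (w); case: (v) => // -[].
  move/(eqpm_toP px py')/eqpm_zeros; rewrite zeros_par_x // => /esym/eqP.
  by rewrite (negPf (zeros_par_y _ _ _ _ _ _ _)).
have [Ex Ey] : toP (par_x i s a b) = toP (par_x j r a' b') /\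
    toP (par_y i s s' a b t c) = toP (par_y j r r' a' b' t' c').
  by move: E; rewrite /par_point wv; case: (v) => -[].
have [ij sr aa bb] := par_x_eqpm a0 b0 a0' b0' (eqpm_toP px px' Ex).
subst j r a' b'.
by have [-> -> ->] := par_y_eqpm a0 b0 c0 tc tc' s0 r0 (eqpm_toP py py' Ey).
Qed.

(** Either [t = 1] and [c = 0], when [par_y] also vanishes at [i]; or [t = 0]
    and [c = 1], which is needed only when [a * b = 0], both vectors being then unit
    vectors. *)
Definition sporadic (T : nat) (a b t c : nat) : bool :=
  (t + c == 1)%N && (maxn a b ^ 2 <= T)%N.

Definition covered (T : nat) (x y : 'rV[int]_3) : Prop :=
  exists i s s' a b t c,
    [/\ generic T s' a b t c || sporadic T a b t c,
        eqpm (par_x i s a b) x & eqpm (par_y i s s' a b t c) y].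

Lemma absz_sign (z : int) : exists e : bool, `|z|%N%:Z = (-1) ^+ e * z.
Proof. by exists (z < 0); case: ltP => z0; rewrite ?expr1 ?expr0; lia. Qed.

Lemma signedP (e : bool) (z : int) :
  exists s, signed s `|z| = (-1) ^+ e * z.
Proof.
have [f] := absz_sign z; rewrite /signed => zE; exists (e (+) f).
by rewrite zE mulrA -signr_addb addbK.
Qed.

Lemma eqpm_mk3 (e : bool) (i : 'I_3) (p q r p' q' r' : int) :
  p = (-1) ^+ e * p' -> q = (-1) ^+ e * q' -> r = (-1) ^+ e * r' ->
  eqpm (mk3 i p q r) (mk3 i p' q' r').
Proof.
move=> -> -> ->; rewrite /eqpm mk3N.
by case: e; [right|left]; rewrite ?expr1 ?expr0 ?mulN1r ?mul1r.
Qed.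

(** A Bezout relation [u * q + v * r = 1] turns the orthogonality of [(q', r')]
    and [(q, r)] into [(q', r') = tau * (r, - q)] with
    [tau = v * q' - u * r']. The parameters are then the absolute values of [q],
    [r], [tau] and [p']. *)
Lemma covered_basic (T : nat) (i : 'I_3) (p q r p' q' r' : int)
    (x := mk3 i 0 q r) (y := mk3 i p' q' r') :
  primitive x -> primitive y -> dot x y = 0 ->
  [\/ q != 0 /\ r != 0, p' = 0 | q' = 0 /\ r' = 0] ->
  (maxnorm x * maxnorm y <= T)%N -> covered T x y.
Proof.
move=> /primitive_mk3; rewrite gcd0n => qr /primitive_mk3 pqr.
rewrite dot_mk3 mul0r add0r => d cases.
have [[u v] /= bez] : exists uv : int * int, uv.1 * q + uv.2 * r = 1.
  have [u [v uv]] := Bezoutz q r; exists (u, v).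
  by rewrite uv /gcdz qr.
pose tau := v * q' - u * r'.
have q'E : q' = tau * r.
  transitivity ((u * q + v * r) * q' - u * (q * q' + r * r')).
    by rewrite bez d mul1r mulr0 subr0.
  by rewrite /tau; ring.
have r'E : r' = - (tau * q).
  transitivity ((u * q + v * r) * r' - v * (q * q' + r * r')).
    by rewrite bez d mul1r mulr0 subr0.
  by rewrite /tau; ring.
move: tau q'E r'E => tau q'E r'E.
have tp : coprime `|tau| `|p'|.
  move: pqr; rewrite q'E r'E abszN !abszM -muln_gcdr [gcdn `|r| _]gcdnC qr muln1.
  by rewrite gcdnC => /eqP.
have qr1 : coprime `|q| `|r| by apply/eqP.
rewrite !maxnorm_mk3 q'E r'E abszN !abszM [maxn (`|tau| * _)%N _]maxnC -maxnMr.
rewrite absz0 max0n => hT.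
(* The sign of [x] is normalised by that of [q], and the sign of [y] by those of
   [q] and [tau], or of [p'] if [tau] vanishes. *)
have [e eE] := absz_sign q; have [s sE] := signedP e r.
have [f fE] := absz_sign p'; have [g gE] := absz_sign tau.
have [s' [s0 Y]] : exists s', (`|tau|%N == 0%N) ==> ~~ s' /\
    eqpm (par_y i s s' `|q| `|r| `|tau| `|p'|) y.
  have [t0|t0] := eqVneq tau 0.
    exists false; split; first by rewrite implybT.
    rewrite /y q'E r'E t0 !mul0r oppr0; apply: (@eqpm_mk3 f);
      rewrite ?mulr0 ?mul0r ?oppr0 //.
    by rewrite /signed mul1r.
  have [s' s'E] := signedP (e (+) g) p'; exists s'.
  split; first by rewrite absz_eq0 (negPf t0).
  rewrite /y q'E r'E; apply: (@eqpm_mk3 (e (+) g)) => //.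
  - by rewrite sE gE signr_addb; ring.
  - by rewrite eE gE signr_addb; ring.
exists i, s, s', `|q|%N, `|r|%N, `|tau|%N, `|p'|%N; split=> //; last first.
  by apply: (@eqpm_mk3 e); rewrite ?mulr0.
rewrite /generic /sporadic qr1 tp /= !absz_gt0 s0 hT /= andbT.
have [p0|p0] := eqVneq p' 0.
  move: tp hT; rewrite p0 /= /coprime gcdn0 => /eqP ->.
  by rewrite mul1n max0n !andbF.
case: cases p0 => [[-> ->]|->|[]] //; rewrite q'E r'E => q0 r0 p0.
have t0 : tau = 0.
  apply/eqP; case: (eqVneq tau 0) => // t0.
  move/eqP: q0; rewrite mulf_eq0 (negPf t0) /= => /eqP q0.
  move/eqP: r0; rewrite oppr_eq0 mulf_eq0 (negPf t0) /= => /eqP r0.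
  by move: qr; rewrite q0 r0.
move: tp hT; rewrite t0 /= /coprime gcd0n => /eqP ->.
move: qr; rewrite /= !mul0n maxn0 muln1 ?andbT.
have [->|q1] := eqVneq q 0; first by rewrite gcd0n max0n => ->.
have [->|r1] := eqVneq r 0; first by rewrite gcdn0 maxn0 => ->.
by [].
Qed.

(** If [x] has a second vanishing coordinate it is a unit vector; when [y] has
    two nonzero coordinates, one of them at [i], the generic parametrisation is
    the one where [y] plays the part of [par_x]. *)
Lemma covered_or (T : nat) (i : 'I_3) (x y : 'rV[int]_3) :
  primitive x -> primitive y -> dot x y = 0 -> x ord0 i = 0 ->
  (maxnorm x * maxnorm y <= T)%N -> covered T x y \/ covered T y x.
Proof.
move=> px py d xi hT; move: px py d hT.
rewrite (mk3_eta i x) (mk3_eta i y) xi.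
move: (x ord0 (i + 1)) (x ord0 (i + 2)) => q r.
move: (y ord0 i) (y ord0 (i + 1)) (y ord0 (i + 2)) => p' q' r'.
have [q0|q0] := eqVneq q 0; last have [r0|r0] := eqVneq r 0.
- move=> px py d hT; have r0 : r != 0.
    by apply/eqP => r0; move/primitive_mk3: px; rewrite q0 r0.
  have r'0 : r' = 0.
    move: d; rewrite dot_mk3 q0 !mul0r !add0r => /eqP.
    by rewrite mulf_eq0 (negPf r0) /= => /eqP.
  have [p0|p0] := eqVneq p' 0; first by left; apply: covered_basic => //;
    apply: Or32.
  right; move: px py d hT; rewrite q0 r'0 !(mk3_rot i) !(mk3_rot (i + 1)).
  move=> px py d hT; apply: covered_basic; rewrite 1?dotC 1?mulnC //.
  exact: Or33.
- move=> px py d hT.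
  have q'0 : q' = 0.
    move: d; rewrite dot_mk3 r0 !mul0r addr0 add0r => /eqP.
    by rewrite mulf_eq0 (negPf q0) /= => /eqP.
  have [p0|p0] := eqVneq p' 0; first by left; apply: covered_basic => //;
    apply: Or32.
  right; move: px py d hT; rewrite r0 q'0 !(mk3_rot i).
  move=> px py d hT; apply: covered_basic; rewrite 1?dotC 1?mulnC //.
  exact: Or33.
- by move=> px py d hT; left; apply: covered_basic => //; apply: Or31.
Qed.

Lemma covered_par_point (T : nat) (x y : 'rV[int]_3) (p : P2Q * P2Q) :
  represents x p.1 -> represents y p.2 -> covered T x y \/ covered T y x ->
  exists w i s s' a b t c,
    (generic T s' a b t c || sporadic T a b t c) /\
    p = par_point w i s s' a b t c.
Proof.
case: p => P Q /= xP yQ [] [i [s [s' [a [b [t [c [h ex ey]]]]]]]].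
- exists true, i, s, s', a, b, t, c; split=> //.
  by rewrite /par_point (toP_eqpm xP ex) (toP_eqpm yQ ey).
- exists false, i, s, s', a, b, t, c; split=> //.
  by rewrite /par_point (toP_eqpm yQ ex) (toP_eqpm xP ey).
Qed.

Lemma boundary_par_point (T : nat) (p : P2Q * P2Q) : boundary T p ->
  exists w i s s' a b t c,
    (generic T s' a b t c || sporadic T a b t c) /\
    p = par_point w i s s' a b t c.
Proof.
have rx := prim_repP p.1; have ry := prim_repP p.2.
move=> [/(boundary_represents rx ry)[d [i z]] hT].
apply: (covered_par_point rx ry).
case: z => z; first exact: (covered_or rx.1 ry.1 d z hT).
rewrite dotC in d; rewrite mulnC in hT.
by have [] := covered_or ry.1 rx.1 d z hT; [right|left].
Qed.

(** * Counting parameters *)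

Lemma sum_nat_drop0 (n : nat) (F : nat -> nat) : F 0%N = 0%N ->
  (\sum_(i < n.+1) F i = \sum_(1 <= i < n.+1) F i)%N.
Proof. by move=> F0; rewrite -(big_mkord xpredT F) big_ltn // F0. Qed.

Lemma coprime_pairs_widen (X Y T : nat) : (X <= T)%N -> (Y <= T)%N ->
  (\sum_(1 <= t < T.+1) \sum_(1 <= c < T.+1)
     coprime t c * ((t <= X) && (c <= Y)) = coprime_pairs X Y)%N.
Proof.
move=> XT YT; rewrite /coprime_pairs (@big_nat_widen _ _ _ 1 X.+1 T.+1) ?ltnS //.
rewrite [RHS]big_mkcond /=; apply: eq_bigr => t _; rewrite ltnS.
case: ifP => tX; last by apply: big1 => c _; rewrite muln0.
rewrite (@big_nat_widen _ _ _ 1 Y.+1 T.+1) ?ltnS // [RHS]big_mkcond /=.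
by apply: eq_bigr => c _; rewrite ltnS; case: ifP; rewrite ?muln1 ?muln0.
Qed.

Lemma height_cond (T m t c : nat) : (0 < m)%N ->
  (m * maxn c (t * m) <= T)%N = (t <= T %/ m ^ 2)%N && (c <= T %/ m)%N.
Proof.
move=> m0; rewrite maxnMr geq_max !leq_divRL ?expn_gt0 ?m0 // andbC.
by rewrite -mulnn mulnCA mulnC [(c * m)%N]mulnC.
Qed.

(** The admissible [(t, c)] with [t > 0] for a pair [(a, b)] of maximum [m],
    see [height_cond]. *)
Definition fibre_count (T m : nat) : nat := coprime_pairs (T %/ m ^ 2) (T %/ m).

(** For [t = 0] only [c = 1] is coprime to [t]. *)
Lemma sum_generic_tc (T : nat) (s' : bool) (a b : nat) :
  (0 < a <= T)%N -> (0 < b <= T)%N ->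
  (\sum_(t < T.+1) \sum_(c < T.+1) generic T s' a b t c =
   coprime a b * (~~ s' + fibre_count T (maxn a b)))%N.
Proof.
move=> /andP[a0 aT] /andP[b0 bT].
have T0 : (0 < T)%N by exact: leq_trans aT.
have m0 : (0 < maxn a b)%N by rewrite leq_max a0.
have mT : (maxn a b <= T)%N by rewrite geq_max aT.
under eq_bigr => t _.
  rewrite (@sum_nat_drop0 T (fun c => generic T s' a b t c)); last first.
    by rewrite /generic /= !andbF.
  over.
rewrite -(big_mkord xpredT (fun t => \sum_(1 <= c < T.+1) generic T s' a b t c)%N).
rewrite big_ltn // mulnDr; congr (_ + _)%N.
  have g0 c : (0 < c)%N ->
      generic T s' a b 0 c = [&& c == 1%N, coprime a b & ~~ s'].
    move=> c0; rewrite /generic a0 b0 c0 mul0n maxn0 [coprime 0 c]/coprime gcd0n.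
    by case: eqP => [->|_]; rewrite ?andbF // muln1 mT !andbT.
  rewrite big_ltn // g0 //= mulnb big_nat big1 ?addn0 // => c /andP[c1 _].
  by rewrite g0 ?(ltnW c1) // gtn_eqF.
rewrite /fibre_count -(@coprime_pairs_widen _ _ T) ?leq_div //.
rewrite big_distrr; apply: eq_big_nat => t /andP[t0 _].
rewrite big_distrr; apply: eq_big_nat => c /andP[c0 _].
rewrite /generic a0 b0 c0 (gtn_eqF t0) /= -height_cond //.
by rewrite mulnb mulnb.
Qed.

Lemma sum_generic (T : nat) (s' : bool) : (0 < T)%N ->
  (\sum_(a < T.+1) \sum_(b < T.+1) \sum_(t < T.+1) \sum_(c < T.+1)
      generic T s' a b t c + coprime_pairs T T =
   ~~ s' * coprime_pairs T T +
   2 * \sum_(1 <= m < T.+1) totient m * fibre_count T m)%N.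
Proof.
move=> T0; rewrite -sum_coprime_max // /fibre_count exp1n !divn1 -!/(fibre_count _ _).
rewrite addnA; congr (_ + _)%N.
pose F a b := (\sum_(t < T.+1) \sum_(c < T.+1) generic T s' a b t c)%N.
have F0 a b : (a == 0%N) || (b == 0%N) -> F a b = 0%N.
  move=> ab; rewrite /F big1 // => t _; rewrite big1 // => c _.
  by rewrite /generic; case/orP: ab => /eqP ->; rewrite ltnn !andbF.
rewrite (@sum_nat_drop0 T (fun a => \sum_(b < T.+1) F a b)%N); last first.
  by rewrite big1 // => b _; rewrite F0.
rewrite [X in (~~ s' * X)%N]/coprime_pairs big_distrr -big_split /=.
apply: eq_big_nat => a aT.
rewrite (@sum_nat_drop0 T (F a)); last by rewrite F0 ?orbT.
rewrite big_distrr -big_split /=; apply: eq_big_nat => b bT.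
by rewrite /F sum_generic_tc // mulnDr [(~~ s' * _)%N]mulnC.
Qed.

Definition param (T : nat) : finType :=
  ((bool * 'I_3 * bool * bool) * ('I_T.+1 * 'I_T.+1 * 'I_T.+1 * 'I_T.+1))%type.

Definition generic_param (T : nat) : pred (param T) :=
  fun k => let: (_, s', (a, b, t, c)) := k in generic T s' a b t c.
Arguments generic_param : clear implicits.

Definition param_point (T : nat) (k : param T) : P2Q * P2Q :=
  let: (w, i, s, s', (a, b, t, c)) := k in par_point w i s s' a b t c.

(** The value [t = 0] is counted for [s' = false] only, and the data
    [(w, i, s)] take [12] values. The sum stops at [M] because [T %/ m ^ 2] is
    [0] beyond. *)
Lemma card_generic_param (T M : nat) : (0 < T)%N -> (M ^ 2 <= T < M.+1 ^ 2)%N ->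
  (#|generic_param T| + 12 * coprime_pairs T T =
   48 * \sum_(1 <= m < M.+1) totient m * fibre_count T m)%N.
Proof.
move=> T0 /andP[MT TM].
have MleT : (M <= T)%N by nia.
have -> : (\sum_(1 <= m < M.+1) totient m * fibre_count T m =
    \sum_(1 <= m < T.+1) totient m * fibre_count T m)%N.
  rewrite [RHS](@big_cat_nat _ _ _ M.+1) //= [X in (_ + X)%N]big_nat.
  rewrite [X in (_ + X)%N]big1 ?addn0 // => m /andP[Mm _].
  rewrite /fibre_count divn_small; last by nia.
  by rewrite /coprime_pairs big_geq ?muln0.
pose H s' := (\sum_(a < T.+1) \sum_(b < T.+1) \sum_(t < T.+1) \sum_(c < T.+1)
      generic T s' a b t c)%N.
have HE s' : (H s' + coprime_pairs T T = ~~ s' * coprime_pairs T T +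
   2 * \sum_(1 <= m < T.+1) totient m * fibre_count T m)%N by exact: sum_generic.
suff -> : #|generic_param T| = (12 * (H true + H false))%N.
  by have := HE true; have := HE false; lia.
rewrite -sum1_card big_mkcond /=.
transitivity (\sum_(u : bool * 'I_3 * bool * bool)
   \sum_(v : 'I_T.+1 * 'I_T.+1 * 'I_T.+1 * 'I_T.+1)
     generic T u.2 v.1.1.1 v.1.1.2 v.1.2 v.2)%N.
  rewrite pair_bigA /=; apply: eq_bigr => [[[[[w i] s] s'] [[[a b] t] c]] _] /=.
  by rewrite /generic_param unfold_in; case: ifP.
transitivity (\sum_(u : bool * 'I_3 * bool * bool) H u.2)%N.
  by apply: eq_bigr => u _; rewrite /H !pair_bigA.
rewrite -(pair_bigA _ (fun _ s' => H s')) /= sum_nat_const.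
by rewrite !card_prod card_bool card_ord big_bool.
Qed.

(** The bit replaces the two values of [(t, c)] with [t + c = 1], and [M] is the
    integral part of the square root of [T]. *)
Definition sporadic_param (M : nat) : finType :=
  ((bool * 'I_3 * bool * bool) * ('I_M.+1 * 'I_M.+1 * bool))%type.

Definition sporadic_point (M : nat) (k : sporadic_param M) : P2Q * P2Q :=
  let: (w, i, s, s', (a, b, e)) := k in
  par_point w i s s' a b (nat_of_bool e) (nat_of_bool (~~ e)).

(** Generic parameters inject into the boundary, and together with the sporadic
    ones they cover it. *)
Lemma size_boundary (T M : nat) (l : seq (P2Q * P2Q)) :
  (M ^ 2 <= T < M.+1 ^ 2)%N -> uniq l -> (forall p, p \in l <-> boundary T p) ->
  (#|generic_param T| <= size l <= #|generic_param T| + 48 * M.+1 ^ 2)%N.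
Proof.
move=> /andP[MT TM] ul lP; apply/andP; split.
  rewrite cardE -(size_map (@param_point T)); apply: uniq_leq_size.
    rewrite map_inj_in_uniq ?enum_uniq // => k k'; rewrite !mem_enum.
    move: k k' => [[[[w i] s] s'] [[[a b] t] c]] [[[[w' i'] r] r'] [[[a' b'] t'] c']].
    move=> g g' /(par_point_inj g g') [[-> -> -> ->] [A B C D]].
    by do !congr pair; apply: val_inj.
  move=> p /mapP[k]; rewrite mem_enum => gk ->; apply/lP.
  by move: k gk => [[[[w i] s] s'] [[[a b] t] c]]; exact: par_point_boundary.
have -> : (48 * M.+1 ^ 2 = #|sporadic_param M|)%N.
  by rewrite !card_prod !card_bool !card_ord; nia.
rewrite [X in (X + _)%N]cardE [X in (_ + X)%N]cardE.
rewrite -(size_map (@param_point T)) -(size_map (@sporadic_point M)) -size_cat.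
apply: uniq_leq_size => // p /lP/boundary_par_point[w [i [s [s' [a [b [t [c]]]]]]]].
move=> [/orP[g|/andP[tc mT]] ->]; rewrite mem_cat; apply/orP; [left|right].
  case/and5P: (g) => ab tc a0 b0 /and3P[c0 _ hT].
  have aT : (a < T.+1)%N by nia.
  have bT : (b < T.+1)%N by nia.
  have tT : (t < T.+1)%N by nia.
  have cT : (c < T.+1)%N by nia.
  apply/mapP.
  exists (w, i, s, s', (Ordinal aT, Ordinal bT, Ordinal tT, Ordinal cT)) => //.
  by rewrite mem_enum.
have aM : (a < M.+1)%N by nia.
have bM : (b < M.+1)%N by nia.
apply/mapP; exists (w, i, s, s', (Ordinal aM, Ordinal bM, t == 1%N)).
  by rewrite mem_enum.
by move: tc; case: t => [|[|t]] //; case: c => [|[|c]].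
Qed.

(** * The asymptotic formula *)

Lemma height_leE (R : realType) (B : R) (p : P2Q * P2Q) : 0 <= B ->
  ((height p)%:R <= B) =
  (maxnorm (prim_rep p.1) * maxnorm (prim_rep p.2) <= Num.truncn (Num.sqrt B))%N.
Proof.
move=> B0; rewrite truncn_ge_nat ?sqrtr_ge0 //.
rewrite /height -expnMn natrX -[in LHS](sqr_sqrtr B0).
by rewrite ler_pXn2r ?nnegrE ?sqrtr_ge0.
Qed.

Lemma boundary_count (R : realType) (B : R) : 0 <= B ->
  exists l : seq (P2Q * P2Q),
    [/\ uniq l, forall p, p \in l <-> boundary (Num.truncn (Num.sqrt B)) p &
        (Ncount B)%:R - (N0count B)%:R = (size l)%:R :> R].
Proof.
move=> B0; pose h : set (P2Q * P2Q) := [set p | (height p)%:R <= B]%classic.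
have fV : finite_set (VQ `&` h)%classic by exact: finite_height_le.
have fU : finite_set (UQ `&` h)%classic by exact: finite_height_le.
have UV : (fset_set (UQ `&` h)%classic `<=` fset_set (VQ `&` h)%classic)%fset.
  by apply/fsubsetP => p; rewrite !in_fset_set // !inE => -[[]].
exists (enum_fset (fset_set (VQ `&` h)%classic `\`
                   fset_set (UQ `&` h)%classic)%fset).
split; first exact: fset_uniq.
- move=> p; rewrite -[_ \in enum_fset _]/(_ \in (_ `\` _)%fset) in_fsetD !in_fset_set //.
  rewrite /boundary /= -height_leE //; split.
    move=> /andP[/negP nU]; rewrite inE => -[Vp hp]; split=> //; split=> // Up.
    by apply: nU; rewrite inE.
  move=> [[Vp nU] hp]; apply/andP; split; last by rewrite inE.
  by apply/negP; rewrite inE => -[].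
- rewrite -[size _]/(#|` _|)%fset cardfsDS // natrB //.
  exact: fsubset_leq_card.
Qed.

Lemma ex_floor_sqrt (T : nat) : exists M, (M ^ 2 <= T < M.+1 ^ 2)%N.
Proof.
elim: T => [|T [M MT]]; first by exists 0%N.
by have [h|h] := ltnP T.+1 (M.+1 ^ 2); [exists M|exists M.+1]; nia.
Qed.

Lemma card_generic_param_approx (R : realType) (T M : nat) :
  (0 < T)%N -> (M ^ 2 <= T < M.+1 ^ 2)%N ->
  `|#|generic_param T|%:R - (48 / zeta 3 - 12 / zeta 2) * T%:R ^+ 2|
  <= (288 * (M%:R * T%:R) + 144 * (T%:R ^+ 2 / M%:R) + 72 * T%:R) * harm R T.
Proof.
move=> T0 MT; have M0 : (0 < M)%N by nia.
have /(congr1 (fun n => n%:R : R)) := card_generic_param T0 MT.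
rewrite natrD !natrM natr_sum => cE.
case/andP: MT => MT _; have := @weighted_pairs_approx R T M M0 MT.
rewrite -[X in X * \sum_(_ <= _ < _) _ - _]/(48%:R).
under eq_bigr do rewrite -natrM.
by rewrite -cE addrK.
Qed.

(** [ln 2 >= 1/2] absorbs the constant term of [harm_le_ln]. *)
Lemma harm_le_log (R : realType) (B : R) (T : nat) : 2 <= B -> (0 < T)%N ->
  T%:R <= B -> harm R T <= 6 * ln B ^+ 2.
Proof.
move=> B2 T0 TB; have TR : 0 < T%:R :> R by rewrite ltr0n.
have l2 : 1 / 2 <= ln B.
  have : 1 / 2 <= ln 2 :> R.
    have := @le_ln1Dx R (- (2^-1)); have -> : 1 - 2^-1 = 2^-1 :> R by field.
    by rewrite lnV ?posrE //; move=> /(_ ltac:(lra)); lra.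
  by move=> h; apply: le_trans h _; rewrite ler_ln ?posrE; lra.
have lT : ln T%:R <= ln B by rewrite ler_ln ?posrE; lra.
have := harm_le_ln R T0; nra.
Qed.

(** All error terms in the scale [b = B ^ (1/4)]: [T] is about [b ^ 2] and [M]
    about [b]. Replacing [T ^ 2] by [B] costs [O(T)]. *)
Lemma error_bound (R : realType) (b T M h D g k : R) :
  1 <= b -> 1 <= h -> 1 <= T -> 1 <= M ->
  T ^+ 2 <= b ^+ 4 -> b ^+ 4 <= (T + 1) ^+ 2 -> M ^+ 2 <= T ->
  T + 1 <= (M + 1) ^+ 2 -> -48 <= k <= 48 ->
  `|D - g| <= 48 * (M + 1) ^+ 2 ->
  `|g - k * T ^+ 2| <= (288 * (M * T) + 144 * (T ^+ 2 / M) + 72 * T) * h ->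
  `|D - k * b ^+ 4| <= 984 * (b ^+ 3 * h).
Proof.
move=> b1 h1 T1 M1 Tb bT MT TM /andP[k1 k2] Dg gk.
have b0 : 0 <= b by lra.
have b2 : 1 <= b ^+ 2 by rewrite exprn_ege1.
have b23 : b ^+ 2 <= b ^+ 3 by rewrite [b ^+ 3]exprS ler_peMl ?exprn_ge0.
have b4 : b ^+ 4 = b ^+ 2 ^+ 2 by rewrite -exprM.
have T2 : T <= b ^+ 2.
  by move: Tb; rewrite b4 ler_pXn2r ?nnegrE //; lra.
have T3 : b ^+ 2 <= T + 1.
  by move: bT; rewrite b4 ler_pXn2r ?nnegrE //; lra.
have Mb : M <= b.
  have : M ^+ 2 <= b ^+ 2 by lra.
  by rewrite ler_pXn2r ?nnegrE //; lra.
have bM : b <= 2 * M.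
  have : b ^+ 2 <= (M + 1) ^+ 2 by lra.
  by rewrite ler_pXn2r ?nnegrE //; lra.
have MTb : M * T <= b ^+ 3.
  by rewrite exprS ler_pM; lra.
have TMb : T ^+ 2 / M <= 2 * b ^+ 3.
  rewrite ler_pdivrMr; last by lra.
  have -> : 2 * b ^+ 3 * M = 2 * M * b ^+ 3 by ring.
  by apply: le_trans Tb _; rewrite [b ^+ 4]exprS ler_wpM2r ?exprn_ge0.
have M1b : (M + 1) ^+ 2 <= 4 * b ^+ 3 by nra.
have TB : `|k * T ^+ 2 - k * b ^+ 4| <= 144 * b ^+ 3.
  rewrite -mulrBr normrM distrC [ `|b ^+ 4 - _| ]ger0_norm ?subr_ge0 //.
  have k3 : `|k| <= 48 by rewrite ler_norml; lra.
  have e : b ^+ 4 - T ^+ 2 <= 3 * b ^+ 3 by nra.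
  apply: le_trans (ler_pM _ _ k3 e) _; rewrite ?subr_ge0 //; lra.
have main : (288 * (M * T) + 144 * (T ^+ 2 / M) + 72 * T) * h <= 648 * (b ^+ 3 * h).
  by rewrite [leRHS]mulrA ler_wpM2r; lra.
have b3h : b ^+ 3 <= b ^+ 3 * h by rewrite ler_peMr ?exprn_ge0.
have -> : D - k * b ^+ 4 =
  (D - g) + (g - k * T ^+ 2) + (k * T ^+ 2 - k * b ^+ 4) by ring.
apply: le_trans (ler_normD _ _) _.
apply: le_trans (lerD (ler_normD _ _) (lexx _)) _; lra.
Qed.

Theorem mainTheorem5 (R : realType) :
  exists C : R, forall B : R, 2 <= B ->
    `| ((Ncount B)%:R - (N0count B)%:R)
       - (48 / zeta 3 - 12 / zeta 2) * B |
    <= C * (B `^ (3 / 4) * ln B ^+ 2).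
Proof.
(* [984] comes from [error_bound] and [6] from [harm_le_log]. *)
exists (984 * 6) => B B2; have B0 : 0 <= B by lra.
pose T := Num.truncn (Num.sqrt B).
have [M MT] := ex_floor_sqrt T.
have s1 : 1 <= Num.sqrt B by rewrite -sqrtr1 ler_sqrt; lra.
have T0 : (0 < T)%N by rewrite truncn_ge_nat ?sqrtr_ge0.
have M0 : (0 < M)%N by nia.
have [l [ul lP ->]] := boundary_count B0.
have /andP[l1 l2] := size_boundary MT ul lP.
have T2B : T%:R ^+ 2 <= B.
  rewrite -(sqr_sqrtr B0) ler_pXn2r ?nnegrE ?sqrtr_ge0 //.
  by rewrite truncn_le ?sqrtr_ge0.
have BT : B <= (T%:R + 1) ^+ 2.
  rewrite -{1}(sqr_sqrtr B0) ler_pXn2r ?nnegrE ?sqrtr_ge0 ?addr_ge0 //.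
  by rewrite natr1 ltW // truncnS_gt.
pose b := B `^ 4^-1.
have b0 : 0 <= b by exact: powR_ge0.
have bX n : b ^+ n = B `^ (4^-1 * n%:R) by rewrite -powR_mulrn // -powRrM.
have b4 : b ^+ 4 = B by rewrite bX mulVf ?powRr1 ?pnatr_eq0.
have b3 : b ^+ 3 = B `^ (3 / 4) by rewrite bX mulrC.
have b1 : 1 <= b.
  by rewrite -(@ler_pXn2r _ 4) ?nnegrE // b4 expr1n; lra.
have T1 : 1 <= T%:R :> R by rewrite ler1n.
have M1 : 1 <= M%:R :> R by rewrite ler1n.
have z2 : 1 <= zeta (2 : R) by exact: (@zeta_ge1 R 2).
have z3 : 1 <= zeta (3 : R) by exact: (@zeta_ge1 R 3).
have i2 : 0 <= (zeta (2 : R))^-1 <= 1 by rewrite invr_ge0 invf_le1; lra.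
have i3 : 0 <= (zeta (3 : R))^-1 <= 1 by rewrite invr_ge0 invf_le1; lra.
have := @error_bound R b T%:R M%:R (harm R T) (size l)%:R #|generic_param T|%:R
  (48 / zeta 3 - 12 / zeta 2).
rewrite b4 b3 => H.
have {}H : `|(size l)%:R - (48 / zeta 3 - 12 / zeta 2) * B| <=
    984 * (B `^ (3 / 4) * harm R T).
  apply: H => //; last exact: card_generic_param_approx.
  - exact: harm_ge1.
  - by rewrite -natrX ler_nat; case/andP: MT.
  - by rewrite !natr1 -natrX ler_nat; case/andP: MT.
  - by move: i2 i3; lra.
  - rewrite ger0_norm ?subr_ge0 ?ler_nat // lerBlDl natr1 -natrX -natrM -natrD.
    by rewrite ler_nat.
have hB : harm R T <= 6 * ln B ^+ 2 by apply: harm_le_log => //; nra.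
apply: le_trans H _; rewrite -[leRHS]mulrA ler_wpM2l ?ler0n //.
by rewrite [leRHS]mulrCA ler_wpM2l ?powR_ge0.
Qed.
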